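(* Let $R$ be a quasi-fiber product ring. Then $R$ satisfies the Generalized Auslander-Reiten condition: for every finitely generated $R$-module $M$ and every positive integer $n$, if $\operatorname{Ext}^i_R(M,M\oplus R)=0$ for all $i\ge n$, then $\operatorname{pd}_R M<n$. Consequently $R$ also satisfies the Auslander-Reiten condition: if $M$ is a finitely generated $R$-module with $\operatorname{Ext}^i_R(M,M\oplus R)=0$ for all $i\ge 1$, then $M$ is free.
   Context: All local rings are commutative and Noetherian; $\operatorname{pd}$ denotes projective dimension. A local ring $(R,\mathfrak m,k)$ is a fiber product ring if $R\cong S\times_k T=\{(s,t)\in S\times T : \pi_S(s)=\pi_T(t)\}$, where $S,T$ are local rings with the same residue field $k$, neither of them equal to $k$, and $\pi_S,\pi_T$ are the reductions modulo the maximal ideals. Equivalently, $\mathfrak m=I\oplus J$ for nonzero ideals $I,J$ of $R$. A local ring $R$ is a quasi-fiber product ring if there is an $R$-regular sequence $\underline x=x_1,\dots,x_r$ with $r\ge 0$ such that $R/(\underline x)$ is a fiber product ring. *)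

(* Defs.v *)
From HB Require Import structures.
From mathcomp Require Import all_boot all_algebra.
From mathcomp Require Import boolp.

Set Implicit Arguments.
Unset Strict Implicit.
Unset Printing Implicit Defensive.

Import GRing.Theory.
Local Open Scope ring_scope.

(* Ideals are boolean predicates, as in ring_quotient; [asbool] makes every
   subset available in this form. *)
Definition ideal_span (R : comNzRingType) (xs : seq R) : {pred R} :=
  fun a => `[< exists c : 'I_(size xs) -> R, a = \sum_i c i * xs`_i >].

(* [idealr_closed] only describes proper ideals; the unit ideal is always
   finitely generated. *)
Definition noetherian (R : comNzRingType) : Prop :=
  forall I : {pred R}, idealr_closed I -> exists xs : seq R, I =i ideal_span xs.

Definition maximal_ideal (R : comNzRingType) (m : {pred R}) : Prop :=
  idealr_closed m /\
  forall I : {pred R}, idealr_closed I -> {subset m <= I} -> I =i m.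

Definition local_ring (R : comNzRingType) : Prop :=
  noetherian R /\
  exists m : {pred R},
    maximal_ideal m /\ forall m' : {pred R}, maximal_ideal m' -> m' =i m.

Definition surjective (A B : Type) (f : A -> B) : Prop :=
  forall b, exists a, f a = b.

Section Quotient.
Variables (R : comNzRingType) (xs : seq R) (hxs : 1 \notin ideal_span xs).

Definition proper_span of 1 \notin ideal_span xs : {pred R} := ideal_span xs.

Fact proper_span_idealr_closed : idealr_closed (proper_span hxs).
Proof.
split=> // [|a u v /asboolP[c ->] /asboolP[d ->]]; apply/asboolP.
  by exists (fun=> 0); rewrite big1 // => i _; rewrite mul0r.
exists (fun i => a * c i + d i); rewrite mulr_sumr -big_split /=.
by apply: eq_bigr => i _; rewrite mulrDl mulrA.
Qed.

HB.instance Definition _ :=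
  isIdealr.Build R (proper_span hxs) proper_span_idealr_closed.

Definition quotient_ring : comNzRingType := {ideal_quot (proper_span hxs)}.

End Quotient.

Section FiberProduct.
Variables (S T : comNzRingType) (k : fieldType).
Variables (piS : {rmorphism S -> k}) (piT : {rmorphism T -> k}).

Definition fiber_pred : {pred S * T} := [pred st | piS st.1 == piT st.2].

Fact fiber_subring_closed : subring_closed fiber_pred.
Proof.
split=> [|x y|x y]; rewrite !inE /=; first by rewrite !rmorph1.
- by move=> /eqP ex /eqP ey; rewrite !rmorphB /= ex ey.
- by move=> /eqP ex /eqP ey; rewrite !rmorphM /= ex ey.
Qed.

HB.instance Definition _ :=
  GRing.isSubringClosed.Build (S * T)%type fiber_pred fiber_subring_closed.

Record fiber_product :=
  FiberProduct { fiber_val : S * T; fiberP : fiber_val \in fiber_pred }.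

HB.instance Definition _ := [isSub for fiber_val].
HB.instance Definition _ := [Choice of fiber_product by <:].
HB.instance Definition _ := [SubChoice_isSubComNzRing of fiber_product by <:].

End FiberProduct.

(* A surjection from a local ring onto a field is the reduction modulo the
   maximal ideal, so [piS] and [piT] identify [k] with both residue fields. *)
Definition fiber_product_ring (Q : comNzRingType) : Prop :=
  local_ring Q /\
  exists (S T : comNzRingType) (k : fieldType)
         (piS : {rmorphism S -> k}) (piT : {rmorphism T -> k}),
    [/\ local_ring S /\ local_ring T,
        surjective piS /\ surjective piT,
        ~ bijective piS /\ ~ bijective piT
      & exists phi : {rmorphism Q -> fiber_product piS piT}, bijective phi].

(* The first conjunct says that xs_i is a nonzerodivisor modulo
   (xs_0, ..., xs_(i-1)), the second one that R/(xs) is nonzero. *)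
Definition regular_sequence (R : comNzRingType) (xs : seq R) : Prop :=
  (forall (i : 'I_(size xs)) (a : R),
     xs`_i * a \in ideal_span (take i xs) -> a \in ideal_span (take i xs)) /\
  1 \notin ideal_span xs.

Definition quasi_fiber_product_ring (R : comNzRingType) : Prop :=
  local_ring R /\
  exists (xs : seq R) (hxs : regular_sequence xs),
    fiber_product_ring (quotient_ring (proj2 hxs)).

Section Modules.
Variable R : comNzRingType.

Definition fin_gen (M : lmodType R) : Prop :=
  exists (r : nat) (g : 'I_r -> M),
    forall m : M, exists c : 'I_r -> R, m = \sum_i c i *: g i.

(* Freeness for finitely generated modules: their bases are finite. *)
Definition fin_free (M : lmodType R) : Prop :=
  exists (r : nat) (b : 'I_r -> M),
    forall m : M, exists! c : 'rV[R]_r, m = \sum_i c 0 i *: b i.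

Definition projective (P : lmodType R) : Prop :=
  forall (A B : lmodType R) (g : {linear A -> B}) (f : {linear P -> B}),
    surjective g -> exists h : {linear P -> A}, forall x, g (h x) = f x.

Record proj_resolution (M : lmodType R) := ProjResolution {
  res_obj :> nat -> lmodType R;
  res_diff : forall i, {linear res_obj i.+1 -> res_obj i};
  res_aug : {linear res_obj 0%N -> M};
  res_projective : forall i, projective (res_obj i);
  res_aug_surj : surjective res_aug;
  res_exact0 : forall x : res_obj 0%N,
    res_aug x = 0 <-> exists y, res_diff 0 y = x;
  res_exact : forall i (x : res_obj i.+1),
    res_diff i x = 0 <-> exists y, res_diff i.+1 y = x
}.

Section Cohomology.
Variables (M N : lmodType R) (P : proj_resolution M).

Definition cocycle (i : nat) (f : {linear P i -> N}) : Prop :=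
  forall y, f (res_diff P i y) = 0.

Definition coboundary (i : nat) : {linear P i -> N} -> Prop :=
  match i with
  | 0 => fun f => forall x, f x = 0
  | j.+1 => fun f =>
      exists g : {linear P j -> N}, forall x, f x = g (res_diff P j x)
  end.

End Cohomology.

(* Ext^i(M, N) = 0, that is H^i(Hom(P, N)) = 0 for a projective resolution P
   of M; by the comparison theorem the choice of P is immaterial. *)
Definition Ext_zero (i : nat) (M N : lmodType R) : Prop :=
  exists P : proj_resolution M,
    forall f : {linear P i -> N}, cocycle f -> coboundary f.

(* pd M < n: M has a projective resolution concentrated in degrees < n. *)
Definition pd_lt (M : lmodType R) (n : nat) : Prop :=
  exists P : proj_resolution M, forall i, (n <= i)%N -> forall x : P i, x = 0.

Definition generalized_auslander_reiten : Prop :=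
  forall (M : lmodType R) (n : nat), fin_gen M -> (0 < n)%N ->
    (forall i, (n <= i)%N -> Ext_zero i M (M * R^o)%type) -> pd_lt M n.

Definition auslander_reiten : Prop :=
  forall M : lmodType R, fin_gen M ->
    (forall i, (1 <= i)%N -> Ext_zero i M (M * R^o)%type) -> fin_free M.

End Modules.

(* Main.v *)
Require Import Defs.
From HB Require Import structures.
From mathcomp Require Import all_boot all_algebra.
From mathcomp Require Import boolp classical_sets.

Set Implicit Arguments.
Unset Strict Implicit.
Unset Printing Implicit Defensive.

Import GRing.Theory.
Local Open Scope ring_scope.

(** Let D be the matrices of a minimal free resolution of M, with F_i the free
    module of index i, of rank b_i. The vanishing of Ext^i(M, R) and Ext^i(M, M)
    for i >= n becomes a property of D alone, as it does not depend on the
    projective resolution ([cocycle_coboundary_indep]). Dimension shifting along the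
    exact sequences 0 -> coker D_(q+1) -> F_q -> coker D_q -> 0 extends it to
    Ext^i(M, coker D_q) = 0 for i >= n + q, where coker D_q is the q-th syzygy
    of M ([self_orthogonal0]). When the ring is reduced modulo a nonzerodivisor,
    exactness starts one step later and the Ext conditions survive
    ([self_orthogonal_quotient]). After the whole regular sequence there remains
    a minimal complex over the fiber product ring Q = R/(xs), with the same
    ranks b_i, exact from the index s = length of xs on.

    The maximal ideal of Q is m = I + J, a direct sum of nonzero ideals, so that
    I J = 0. A kernel contained in m F, for a linear map F -> G, splits into its
    parts in I F and J F. If b_(s+2) is not zero, this yields a unimodular w in
    F_(s+2) whose image has all its entries in J, say ([retract_exists]). Then
    a |-> a w embeds I into a syzygy, and a coordinate of w that is a unit gives
    a retraction: I is a direct summand of this syzygy. The next syzygy contains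
    J in the same way ([retract_next]). As the i-th cohomology of the complex
    with values in any of these syzygies vanishes for large i, so does the one
    with values in I and J, hence in m. It also vanishes with values in Q, so it
    vanishes with values in the residue field, which for a minimal complex means
    that b_i = 0 for large i ([rank_zero_eventually]).

    Back over R, the resolution of M is finite, and Ext^i(M, R) = 0 for i >= n
    shortens it: if b_(i+1) = 0, then the identity of F_i is a coboundary, so it
    has its entries in the maximal ideal, and b_i = 0 ([rank_zero_descent]).
    Hence b_i = 0 for all i >= n. *)

(** * Ideals and local rings *)

Section Ideals.
Variables (R : comNzRingType) (I : {pred R}).
Hypothesis hI : idealr_closed I.

Lemma ideal0 : 0 \in I. Proof. by case: hI. Qed.

Lemma ideal1F : 1 \in I -> False.
Proof. by case: hI => _ /negP. Qed.

Lemma idealMl a u : u \in I -> a * u \in I.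
Proof. by case: hI => h0 _ h hu; rewrite -[_ * _]addr0 h. Qed.

Lemma idealMr a u : u \in I -> u * a \in I.
Proof. by rewrite mulrC; apply: idealMl. Qed.

Lemma idealD u v : u \in I -> v \in I -> u + v \in I.
Proof. by case: hI => _ _ h hu hv; rewrite -[u]mul1r h. Qed.

Lemma idealN u : u \in I -> - u \in I.
Proof. by rewrite -mulN1r; apply: idealMl. Qed.

Lemma idealB u v : u \in I -> v \in I -> u - v \in I.
Proof. by move=> hu hv; apply: idealD => //; apply: idealN. Qed.

Lemma ideal_sum n (F : 'I_n -> R) :
  (forall i, F i \in I) -> \sum_i F i \in I.
Proof.
move=> h; apply: (big_ind (fun x => x \in I)) => //; first exact: ideal0.
exact: idealD.
Qed.

(** The matrices with all entries in [I]. *)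
Definition mx_in p q (A : 'M[R]_(p, q)) := forall i j, A i j \in I.

Lemma mx_in_mulr p q r (A : 'M[R]_(p, q)) (B : 'M_(q, r)) :
  mx_in B -> mx_in (A *m B).
Proof. by move=> h i j; rewrite mxE; apply: ideal_sum => l; apply: idealMl. Qed.

Lemma mx_in_mull p q r (A : 'M[R]_(p, q)) (B : 'M_(q, r)) :
  mx_in A -> mx_in (A *m B).
Proof. by move=> h i j; rewrite mxE; apply: ideal_sum => l; apply: idealMr. Qed.

End Ideals.

Section Spans.
Variables (R : comNzRingType) (xs : seq R).

Lemma ideal_span0 : 0 \in ideal_span xs.
Proof.
by apply/asboolP; exists (fun=> 0); rewrite big1 // => i _; rewrite mul0r.
Qed.

Lemma ideal_span_lin a u v :
  u \in ideal_span xs -> v \in ideal_span xs -> a * u + v \in ideal_span xs.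
Proof.
move=> /asboolP[c ->] /asboolP[d ->]; apply/asboolP.
exists (fun i => a * c i + d i); rewrite mulr_sumr -big_split /=.
by apply: eq_bigr => i _; rewrite mulrDl mulrA.
Qed.

Lemma ideal_span_closed : 1 \notin ideal_span xs -> idealr_closed (ideal_span xs).
Proof.
move=> h1; split=> // [|a u v hu hv]; first exact: ideal_span0.
exact: ideal_span_lin.
Qed.

End Spans.

Lemma ideal_span_nil (R : comNzRingType) (a : R) :
  a \in ideal_span [::] <-> a = 0.
Proof.
split=> [/asboolP[c ->]|->]; last exact: ideal_span0.
by rewrite big_ord0.
Qed.

(** Membership in (xs, x) is membership in (xs) modulo multiples of [x]. *)
Lemma ideal_span_rcons (R : comNzRingType) (xs : seq R) (x a : R) :
  a \in ideal_span (rcons xs x) <-> exists c, a - x * c \in ideal_span xs.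
Proof.
split=> [/asboolP[c ->]|[c /asboolP[d hd]]].
  move: c; rewrite size_rcons => c; exists (c ord_max); rewrite big_ord_recr /=.
  rewrite nth_rcons ltnn eqxx mulrC addrK; apply/asboolP.
  exists (fun i => c (widen_ord (leqnSn _) i)); apply: eq_bigr => i _ /=.
  by rewrite nth_rcons ltn_ord.
apply/asboolP; rewrite size_rcons.
exists (fun i => if insub (val i) is Some j then d j else c).
rewrite big_ord_recr /= nth_rcons ltnn eqxx insubF ?ltnn //.
rewrite -(subrK (x * c) a) hd [c * x]mulrC; congr (_ + _).
apply: eq_bigr => i _; rewrite nth_rcons ltn_ord.
by case: insubP => [j _ /val_inj ->|]; rewrite ?ltn_ord.
Qed.

(** [m] is a proper ideal that contains all the nonunits. *)
Definition local_at (R : comNzRingType) (m : {pred R}) :=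
  idealr_closed m /\ forall x, x \notin m -> exists y, x * y = 1.

Lemma local_at_ideal (R : comNzRingType) (m I : {pred R}) x :
  local_at m -> idealr_closed I -> x \in I -> x \in m.
Proof.
move=> [_ hm] hI hx; apply/negPn/negP => /hm[y hy].
by apply: (ideal1F hI); rewrite -hy; apply: idealMr.
Qed.

(** Zorn's lemma for the ideals that contain a given nonunit [x]. *)
Lemma nonunit_maximal_ideal (R : comNzRingType) (x : R) :
  (forall y, x * y <> 1) -> exists2 m : {pred R}, maximal_ideal m & x \in m.
Proof.
move=> hx.
pose P (A : set R) := [/\ ~ A 1,
  forall a u v, A u -> A v -> A (a * u + v)
  & forall a u, A u -> A (u + x * a)].
have [|A [[A1 Al Ax] Amax]] := @Zorn_bigcup _ P.
  move=> F FP Ftot; split.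
  - by case=> X /FP[] /[swap] _ /[swap] _ X1.
  - move=> a u v [X FX Xu] [Y FY Yv].
    have [XY|YX] := Ftot _ _ FX FY.
      by exists Y => //; have [_ h _] := FP _ FY; apply: h => //; apply: XY.
    by exists X => //; have [_ h _] := FP _ FX; apply: h => //; apply: YX.
  - by move=> a u [X FX Xu]; exists X => //; have [_ _ h] := FP _ FX; apply: h.
(* [A] might be empty, the union of the empty chain *)
pose S : set R := fun z => exists c, z = x * c.
have PS : P S.
  split=> [[c h]|a _ _ [c ->] [d ->]|a _ [c ->]]; first by apply: (hx c).
    by exists (a * c + d); rewrite mulrDr mulrCA.
  by exists (c + a); rewrite mulrDr.
have [a0 A0] : exists a, A a.
  apply: contrapT => hA; apply: (Amax S) PS; split=> [z Az|h].
    by case: hA; exists z.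
  by apply: hA; exists 0; apply: h; exists 0; rewrite mulr0.
have Az : A 0 by rewrite -(addNr a0) -mulN1r; apply: Al.
exists (fun z => `[< A z >]).
  split; first by split; [exact/asboolP | apply/negP => /asboolP |
    move=> a u v /asboolP hu /asboolP hv; apply/asboolP; apply: Al].
  move=> I hI AI z; apply/idP/idP; last exact: AI.
  have AI' w : A w -> w \in I by move=> hw; apply: AI; apply/asboolP.
  move=> hz; apply/asboolP; apply: contrapT => nAz.
  apply: (Amax (fun w => w \in I)).
    by split=> [w /AI' //|h]; apply: nAz; apply: h.
  split; first by move/(ideal1F hI).
    by move=> a u v hu hv; apply: idealD => //; apply: idealMl.
  move=> a u hu; apply: idealD => //; apply: idealMr => //; apply: AI'.
  by rewrite -[x]mulr1 -[X in A X]add0r; apply: Ax.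
by apply/asboolP; rewrite -[x]mulr1 -[X in A X]add0r; apply: Ax.
Qed.

(** In a local ring, the complement of the maximal ideal consists of units. *)
Lemma local_ring_at (R : comNzRingType) (m : {pred R}) :
  local_ring R -> maximal_ideal m -> local_at m.
Proof.
move=> [_ [m0 [_ m0u]]] hm; split=> [|x hx]; first by case: hm.
apply: contrapT => hn.
have [|m' hm' xm'] := @nonunit_maximal_ideal R x.
  by move=> y hy; apply: hn; exists y.
by move: hx; rewrite (m0u _ hm) -(m0u _ hm') xm'.
Qed.

(** * Minimal generators *)

(** Submodules of a free module of finite rank are finitely generated, by
    induction on the rank: the leading coefficients form an ideal, and the
    vectors with leading coefficient zero form a submodule of smaller rank. *)
Lemma noetherian_submod (R : comNzRingType) (hR : noetherian R) c
    (S : 'rV[R]_c -> Prop) :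
  S 0 -> (forall a u v, S u -> S v -> S (a *: u + v)) ->
  exists k (K : 'M[R]_(k, c)), forall v, S v <-> exists u, v = u *m K.
Proof.
elim: c S => [|c IH].
  move=> S S0 Sl; exists 0%N, 0 => v; rewrite [v]thinmx0.
  by split=> // _; exists 0; rewrite mul0mx.
rewrite -[c.+1]/(1 + c)%N => S S0 Sl.
(* generators of the ideal of leading coefficients, which need not be proper *)
have [xs hxs] : exists xs : seq R, forall x,
    x \in ideal_span xs <-> exists v, S (row_mx x%:M v).
  pose L x := exists v : 'rV_c, S (row_mx x%:M v).
  have L0 : L 0 by exists 0; rewrite raddf0 row_mx0.
  have Ll a x y : L x -> L y -> L (a * x + y).
    move=> [u Su] [v Sv]; exists (a *: u + v).
    have -> : row_mx (a * x + y)%:M (a *: u + v) =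
              a *: row_mx x%:M u + row_mx y%:M v.
      by rewrite scale_row_mx add_row_mx scale_scalar_mx raddfD.
    exact: Sl.
  have [L1|nL1] := pselect (L 1).
    exists [:: 1] => x; split=> _.
      have := Ll x 1 0 L1 L0; by rewrite mulr1 addr0.
    by apply/asboolP; exists (fun=> x); rewrite big_ord1 mulr1.
  have [|xs hxs] := hR (fun x => `[< L x >]).
    split; [exact/asboolP | by apply/negP => /asboolP|].
    by move=> a u v /asboolP hu /asboolP hv; apply/asboolP; apply: Ll.
  by exists xs => x; rewrite -hxs; split=> /asboolP.
have /choice[w Sw] : forall i : 'I_(size xs), exists v, S (row_mx (xs`_i)%:M v).
  move=> i; apply/hxs/asboolP; exists (fun j => (j == i)%:R).
  by rewrite (bigD1 i) //= eqxx mul1r big1 ?addr0 // => j /negPf->; rewrite mul0r.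
have [||k [K hK]] := IH (fun v => S (row_mx 0 v)).
- by rewrite row_mx0.
- move=> a u v Su Sv; have := Sl a _ _ Su Sv.
  by rewrite scale_row_mx add_row_mx scaler0 addr0.
pose W : 'M[R]_(size xs, 1 + c) := \matrix_i row_mx (xs`_i)%:M (w i).
have SW u : S (u *m W).
  rewrite mulmx_sum_row; apply: (big_ind S) => // [x y Sx Sy|i _].
    by rewrite -[x]scale1r; apply: Sl.
  by rewrite rowK -[_ *: _]addr0; apply: Sl.
exists (size xs + k)%N, (col_mx W (row_mx 0 K)) => v; split=> [Sv|[u ->]].
  rewrite -[v]hsubmxK [lsubmx v]mx11_scalar in Sv *.
  set x := lsubmx v 0 0 in Sv *; set v' := rsubmx v in Sv *.
  have /hxs/asboolP[d hd] : exists v, S (row_mx x%:M v) by exists v'.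
  pose u1 : 'rV[R]_(size xs) := \row_i d i.
  have hu1 : lsubmx (u1 *m W) = x%:M.
    rewrite hd mulmx_sum_row raddf_sum /=; apply/rowP=> i; rewrite !ord1.
    rewrite !mxE eqxx mulr1n summxE; apply: eq_bigr => j _.
    by rewrite rowK !mxE; case: splitP => // l _; rewrite !ord1 mxE eqxx mulr1n.
  have /hK[u2 hu2] : S (row_mx 0 (v' - rsubmx (u1 *m W))).
    have := Sl (-1) _ _ (SW u1) Sv; rewrite -{1}[u1 *m W]hsubmxK hu1.
    by rewrite scaleN1r opp_row_mx add_row_mx addNr addrC.
  exists (row_mx u1 u2); rewrite mul_row_col mul_mx_row mulmx0 -hu2.
  by rewrite -[u1 *m W]hsubmxK hu1 row_mxKr add_row_mx addr0 addrC subrK.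
rewrite -[u]hsubmxK mul_row_col mul_mx_row mulmx0 -[_ *m W]scale1r.
by apply: Sl => //; apply/hK; exists (rsubmx u).
Qed.

Section MinimalGenerators.
Variables (R : comNzRingType) (m : {pred R}).
Hypothesis hm : local_at m.

(** A generating family with as few members as possible has no relation with
    a coefficient outside [m], since such a coefficient is invertible. *)
Lemma minimal_generators (V : lmodType R) (S : V -> Prop) :
  (exists r (g : 'I_r -> V),
      forall v, S v <-> exists c : 'rV[R]_r, v = \sum_i c 0 i *: g i) ->
  exists r (g : 'I_r -> V),
      (forall v, S v <-> exists c : 'rV[R]_r, v = \sum_i c 0 i *: g i) /\
      forall c : 'rV[R]_r, \sum_i c 0 i *: g i = 0 -> mx_in m c.
Proof.
pose Q r (g : 'I_r -> V) := forall v,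
  S v <-> exists c : 'rV[R]_r, v = \sum_i c 0 i *: g i.
move=> [r0 [g0 hg0]].
have ex : exists r, `[< exists g : 'I_r -> V, Q r g >].
  by exists r0; apply/asboolP; exists g0.
case: (ex_minnP ex) => r /asboolP[g hg] rmin; exists r, g; split=> // c hc.
move=> a j; rewrite ord1 {a}; apply/negPn/negP => /(proj2 hm)[y cy].
case: r => [|r] in g hg rmin c hc j cy *; first by case: (j).
have gj : g j = \sum_i (- y * c 0 (lift j i)) *: g (lift j i).
  have : y *: \sum_i c 0 i *: g i = 0 by rewrite hc scaler0.
  rewrite (bigD1_ord j) //= scalerDr scalerA mulrC cy scale1r => /eqP.
  rewrite addr_eq0 => /eqP->; rewrite scaler_sumr -sumrN.
  by apply: eq_bigr => i _; rewrite scalerA mulNr scaleNr.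
suff /rmin: `[< exists g : 'I_r -> V, Q r g >] by rewrite ltnn.
apply/asboolP; exists (fun i => g (lift j i)) => v; rewrite hg; split.
  move=> [d ->]; exists (\row_i (d 0 (lift j i) - d 0 j * y * c 0 (lift j i))).
  rewrite (bigD1_ord j) //= {1}gj scaler_sumr -big_split /=.
  apply: eq_bigr => i _; rewrite mxE scalerA -scalerDl addrC mulrA mulrN.
  by rewrite mulNr.
move=> [d ->].
exists (\row_i if unlift j i is Some i' then d 0 i' else 0).
rewrite (bigD1_ord j) //= mxE unlift_none scale0r add0r.
by apply: eq_bigr => i _; rewrite mxE liftK.
Qed.

Lemma minimal_row_generators c (S : 'rV[R]_c -> Prop) :
  (exists k (K : 'M[R]_(k, c)), forall v, S v <-> exists u, v = u *m K) ->
  exists k (K : 'M[R]_(k, c)), (forall v, S v <-> exists u, v = u *m K) /\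
    forall u : 'rV[R]_k, u *m K = 0 -> mx_in m u.
Proof.
move=> [k0 [K0 hK0]]; have [|k [g [hg gmin]]] := @minimal_generators _ S.
  exists k0, (fun i => row i K0) => v; rewrite hK0.
  by split=> -[u ->]; exists u; rewrite mulmx_sum_row.
have gE (u : 'rV_k) : u *m (\matrix_i g i) = \sum_i u 0 i *: g i.
  by rewrite mulmx_sum_row; apply: eq_bigr => i _; rewrite rowK.
exists k, (\matrix_i g i); split=> [v|u]; last by rewrite gE => /gmin.
by rewrite hg; split=> -[u ->]; exists u; rewrite gE.
Qed.

End MinimalGenerators.

(** * Minimal free resolutions *)

Lemma exact_rows (R : comNzRingType) k c d (A : 'M[R]_(k, c)) (B : 'M[R]_(d, c)) :
  (forall i, exists u, row i A = u *m B) -> exists U, A = U *m B.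
Proof.
move=> /choice[u hu]; exists (\matrix_i u i).
by apply/row_matrixP => i; rewrite row_mul rowK.
Qed.

(** A row vector [u] stands for an element of a free module and [D i] is the
    map [u |-> u *m D i] from rank [b i.+1] to rank [b i]; the family
    [g] gives the augmentation. *)
Record minimal_resolution (R : comNzRingType) (m : {pred R}) (M : lmodType R)
    (b : nat -> nat) (D : forall i, 'M[R]_(b i.+1, b i)) (g : 'I_(b 0%N) -> M) :
    Prop := MinimalResolution {
  mr_gen : forall x : M, exists c : 'rV[R]_(b 0%N), x = \sum_i c 0 i *: g i;
  mr_exact0 : forall c : 'rV[R]_(b 0%N),
    \sum_i c 0 i *: g i = 0 <-> exists u, c = u *m D 0%N;
  mr_exact : forall i (v : 'rV[R]_(b i.+1)),
    v *m D i = 0 <-> exists u, v = u *m D i.+1;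
  mr_min : forall i, mx_in m (D i)
}.

Section MinimalResolution.
Variables (R : comNzRingType) (m : {pred R}).
Hypotheses (hR : noetherian R) (hm : local_at m).

(** A matrix together with its dimensions. *)
Record rect_mx := RectMx {
  rm_row : nat; rm_col : nat; rm_mx : 'M[R]_(rm_row, rm_col) }.

Lemma minimal_kernel_generators k c (A : 'M[R]_(k, c)) :
  exists B : {r : nat & 'M[R]_(r, k)},
    (forall v : 'rV_k, v *m A = 0 <-> exists u, v = u *m projT2 B) /\
    forall u : 'rV_(projT1 B), u *m projT2 B = 0 -> mx_in m u.
Proof.
have [|r [B hB]] := @minimal_row_generators _ _ hm k (fun v => v *m A = 0).
  apply: noetherian_submod => //; first exact: mul0mx.
  by move=> a u v hu hv; rewrite mulmxDl -scalemxAl hu hv scaler0 addr0.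
by exists (existT _ r B).
Qed.

(** A matrix whose rows minimally generate the left kernel of [A]. *)
Definition kernel_gens (A : rect_mx) :=
  sval (cid (minimal_kernel_generators (rm_mx A))).

Definition next_syzygy (A : rect_mx) : rect_mx := RectMx (projT2 (kernel_gens A)).

Lemma next_syzygyP (A : rect_mx) :
  (forall v : 'rV_(rm_row A), v *m rm_mx A = 0 <->
     exists u, v = u *m rm_mx (next_syzygy A)) /\
  forall u : 'rV_(rm_row (next_syzygy A)),
    u *m rm_mx (next_syzygy A) = 0 -> mx_in m u.
Proof. exact: svalP (cid (minimal_kernel_generators (rm_mx A))). Qed.

Lemma minimal_resolution_exists (M : lmodType R) : fin_gen M ->
  exists b D g, @minimal_resolution R m M b D g.
Proof.
move=> [r0 [g0 hg0]].
have [|r [g [hg gmin]]] := @minimal_generators _ _ hm M (fun=> True).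
  exists r0, g0 => v; split=> // _; have [c ->] := hg0 v.
  by exists (\row_i c i); apply: eq_bigr => i _; rewrite mxE.
have [|r1 [K [hK Kmin]]] :=
    @minimal_row_generators _ _ hm r (fun c => \sum_i c 0 i *: g i = 0).
  apply: noetherian_submod => //.
    by rewrite big1 // => i _; rewrite mxE scale0r.
  move=> a u v hu hv.
  transitivity (a *: (\sum_i u 0 i *: g i) + \sum_i v 0 i *: g i); last first.
    by rewrite hu hv scaler0 addr0.
  rewrite scaler_sumr -big_split /=; apply: eq_bigr => i _.
  by rewrite !mxE scalerDl scalerA.
pose A i := iter i next_syzygy (RectMx K).
have Amin i (u : 'rV_(rm_row (A i))) : u *m rm_mx (A i) = 0 -> mx_in m u.
  case: i u => [|i] u; first exact: Kmin.
  exact: (proj2 (next_syzygyP (A i))).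
have Aexact i (v : 'rV_(rm_col (A i.+1))) :
    v *m rm_mx (A i) = 0 <-> exists u, v = u *m rm_mx (A i.+1).
  exact: (proj1 (next_syzygyP (A i))).
exists (fun i => rm_col (A i)), (fun i => rm_mx (A i)), g; split=> //.
- by move=> x; apply/hg.
- move=> [|i] j k; last first.
    have /(Amin i) : row j (rm_mx (A i.+1)) *m rm_mx (A i) = 0.
      by apply/Aexact; exists (delta_mx 0 j); rewrite rowE.
    by move=> /(_ 0 k); rewrite mxE.
  have /gmin : \sum_i row j K 0 i *: g i = 0.
    by apply/hK; exists (delta_mx 0 j); rewrite rowE.
  by move=> /(_ 0 k); rewrite mxE.
Qed.

End MinimalResolution.

(** * Vanishing of Ext for a complex of free modules *)

Section ExtConditions.
Variables (R : comNzRingType) (b : nat -> nat) (D : forall i, 'M[R]_(b i.+1, b i)).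

Definition is_complex := forall i, D i.+1 *m D i = 0.

Definition exact_from s := forall i, (s <= i)%N -> forall v : 'rV[R]_(b i.+1),
  v *m D i = 0 -> exists u, v = u *m D i.+1.

(** Vanishing of Ext^(p+1)(-, R) for the cokernel of [D 0], when [D] is a
    resolution of this cokernel. *)
Definition ext_ring_zero p := forall c (f : 'M[R]_(b p.+1, c)),
  D p.+1 *m f = 0 -> exists g, f = D p *m g.

(** Vanishing of Ext^(p+1)(-, coker (D q)), under the same proviso: a map from
    the free module of index [p.+1] to coker (D q) is the class of a matrix [f];
    it is a cocycle if [D p.+1 *m f] factors through [D q], and a coboundary if
    [f] comes from [D p] up to a map that factors through [D q]. *)
Definition ext_syz_zero p q :=
  forall (f : 'M[R]_(b p.+1, b q)) (e : 'M[R]_(b p.+2, b q.+1)),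
  D p.+1 *m f = e *m D q -> exists g h, f = D p *m g + h *m D q.

(** Over a regular quotient the complex is only exact from an index [s] on, and
    the second Ext condition is only kept for the syzygies from [s] on. *)
Record self_orthogonal s n : Prop := SelfOrthogonal {
  so_complex : is_complex;
  so_exact : exact_from s;
  so_ring : forall p, (n <= p.+1)%N -> ext_ring_zero p;
  so_syz : forall p q, (s <= q)%N -> (n + q <= p.+1)%N -> ext_syz_zero p q
}.

Lemma exact_from_mx s i k (A : 'M[R]_(k, b i.+1)) :
  exact_from s -> (s <= i)%N -> A *m D i = 0 -> exists U, A = U *m D i.+1.
Proof.
move=> hD hi hA; apply: exact_rows => j; apply: (hD i hi).
by rewrite -row_mul hA row0.
Qed.

(** Dimension shifting along 0 -> coker (D q.+1) -> F_q -> coker (D q) -> 0: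
    Ext^(p+2)(-, coker (D q.+1)) lies between Ext^(p+1)(-, coker (D q)) and
    Ext^(p+2)(-, F_q). *)
Lemma ext_syz_zero_shift p q :
  is_complex -> exact_from 0 -> ext_ring_zero p.+1 ->
  ext_syz_zero p q -> ext_syz_zero p.+1 q.+1.
Proof.
move=> hc hD L1 hE f e hfe.
have [|f' hf'] := L1 _ (f *m D q); first by rewrite mulmxA hfe -mulmxA hc mulmx0.
have [|g [h hg]] := hE f' f; first by rewrite -hf'.
have [|k hk] := exact_from_mx (A := f - D p.+1 *m h) hD (leq0n q).
  rewrite mulmxBl hf' hg mulmxDr !mulmxA hc mul0mx add0r; exact: subrr.
by exists h, k; rewrite -hk addrC subrK.
Qed.

Lemma self_orthogonal0 n : (0 < n)%N ->
  is_complex -> exact_from 0 -> (forall p, (n <= p.+1)%N -> ext_ring_zero p) ->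
  (forall p, (n <= p.+1)%N -> ext_syz_zero p 0) -> self_orthogonal 0 n.
Proof.
move=> n0 hc hD hL hE; split=> // p q _; elim: q p => [|q IH] p h.
  by apply: hE; rewrite addn0 in h.
case: p h => [|p] h; first by move: h; rewrite -(prednK n0) addnS.
rewrite addnS ltnS in h; have hn := leq_trans (leq_addr q n) h.
apply: ext_syz_zero_shift => //; last exact: IH.
by apply: hL; apply: leqW.
Qed.

End ExtConditions.

(** * Reduction modulo a regular element *)

Section Transfer.
Variables (A B : comNzRingType) (sigma : {rmorphism A -> B}).
Variables (b : nat -> nat) (D : forall i, 'M[A]_(b i.+1, b i)).
Hypothesis sigma_surj : Defs.surjective sigma.

Let Ds i : 'M[B]_(b i.+1, b i) := map_mx sigma (D i).

Lemma lift_mx p q (X : 'M[B]_(p, q)) : exists Y, X = map_mx sigma Y.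
Proof.
have /choice[f hf] : forall ij : 'I_p * 'I_q, exists a, sigma a = X ij.1 ij.2.
  by move=> ij; apply: sigma_surj.
by exists (\matrix_(i, j) f (i, j)); apply/matrixP => i j; rewrite !mxE hf.
Qed.

Lemma is_complex_map : is_complex D -> is_complex Ds.
Proof. by move=> hc i; rewrite -map_mxM hc map_mx0. Qed.

(** Transport along an isomorphism, for the empty regular sequence. *)
Lemma self_orthogonal_bij s n : injective sigma ->
  self_orthogonal D s n -> self_orthogonal Ds s n.
Proof.
move=> si [hc hD hL hE].
have inj p q (X Y : 'M[A]_(p, q)) : map_mx sigma X = map_mx sigma Y -> X = Y.
  by move=> /matrixP h; apply/matrixP => i j; apply: si; have := h i j; rewrite !mxE.
split; first exact: is_complex_map.
- move=> i hi v; have [w ->] := lift_mx v.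
  rewrite -map_mxM -(map_mx0 sigma) => /inj /(hD i hi)[u ->].
  by exists (map_mx sigma u); rewrite map_mxM.
- move=> p hp c f; have [w ->] := lift_mx f.
  rewrite -map_mxM -(map_mx0 sigma) => /inj /(hL p hp)[u ->].
  by exists (map_mx sigma u); rewrite map_mxM.
- move=> p q hq hp f e; have [w ->] := lift_mx f; have [w' ->] := lift_mx e.
  rewrite -!map_mxM => /inj /(hE p q hq hp)[g [h ->]].
  by exists (map_mx sigma g), (map_mx sigma h); rewrite map_mxD !map_mxM.
Qed.

Variable x : A.
Hypothesis sigma_ker : forall a, sigma a = 0 <-> exists c, a = x * c.
Hypothesis x_reg : forall a, x * a = 0 -> a = 0.

Lemma map_mx_ker p q (X Y : 'M[A]_(p, q)) :
  map_mx sigma X = map_mx sigma Y -> exists W, X = Y + x *: W.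
Proof.
move=> /matrixP h.
have /choice[f hf] : forall ij : 'I_p * 'I_q, exists c, (X - Y) ij.1 ij.2 = x * c.
  move=> [i j] /=; apply/sigma_ker; rewrite !mxE rmorphB.
  by have := h i j; rewrite !mxE => ->; rewrite subrr.
exists (\matrix_(i, j) f (i, j)); apply/matrixP => i j.
by rewrite 3!mxE -hf !mxE addrC subrK.
Qed.

Lemma scale_reg p q (W : 'M[A]_(p, q)) : x *: W = 0 -> W = 0.
Proof.
move=> /matrixP h; apply/matrixP => i j; rewrite mxE.
by apply: x_reg; have := h i j; rewrite !mxE.
Qed.

Lemma map_mx_scale p q (Y W : 'M[A]_(p, q)) :
  map_mx sigma (Y + x *: W) = map_mx sigma Y.
Proof.
have sx : sigma x = 0 by apply/sigma_ker; exists 1; rewrite mulr1.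
by rewrite map_mxD map_mxZ sx scale0r addr0.
Qed.

(** In each case a cocycle over [B] lifts to an equation over [A] up to [x *: z].
    As [x] is regular, [z] is itself a cycle or cocycle, in a neighbouring degree,
    hence a boundary or coboundary over [A], and subtracting [x] times a bounding
    element from the lift gives a genuine cycle or cocycle over [A]. *)
Lemma self_orthogonal_quotient s n :
  self_orthogonal D s n -> self_orthogonal Ds s.+1 n.
Proof.
move=> [hc hD hL hE]; split; first exact: is_complex_map.
- move=> [|i] // hi v; have [w ->] := lift_mx v.
  rewrite -map_mxM -(map_mx0 sigma) => /map_mx_ker[z]; rewrite add0r => hz.
  have /(hD i hi)[u hu] : z *m D i = 0.
    by apply: scale_reg; rewrite scalemxAl -hz -mulmxA hc mulmx0.
  have /(hD _ (leqW hi))[t ht] : (w - x *: u) *m D i.+1 = 0.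
    by rewrite mulmxBl hz hu scalemxAl subrr.
  by exists (map_mx sigma t); rewrite -map_mxM -ht -scaleN1r scalerA mulrC
    -scalerA map_mx_scale.
- move=> p hp c f; have [w ->] := lift_mx f.
  rewrite -map_mxM -(map_mx0 sigma) => /map_mx_ker[z]; rewrite add0r => hz.
  have /(hL _ (leqW hp))[u hu] : D p.+2 *m z = 0.
    by apply: scale_reg; rewrite scalemxAr -hz mulmxA hc mul0mx.
  have /(hL _ hp)[t ht] : D p.+1 *m (w - x *: u) = 0.
    by rewrite mulmxBr hz hu scalemxAr subrr.
  by exists (map_mx sigma t); rewrite -map_mxM -ht -scaleN1r scalerA mulrC
    -scalerA map_mx_scale.
- move=> p [|q] // hq hp f e; have [w ->] := lift_mx f; have [y ->] := lift_mx e.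
  rewrite -!map_mxM => /map_mx_ker[z hz].
  (* [x] is regular on the image of [D q], that is on the syzygy coker (D q.+1) *)
  have hzD : (D p.+2 *m z) *m D q = 0.
    apply: scale_reg; rewrite scalemxAl scalemxAr.
    have -> : x *: z = D p.+1 *m w - y *m D q.+1 by rewrite hz addrC addKr.
    by rewrite mulmxBr mulmxBl !mulmxA hc !mul0mx sub0r -!mulmxA hc !mulmx0 oppr0.
  have [U hU] := exact_from_mx hD hq hzD.
  have [g [h hgh]] := hE p.+1 q.+1 (leqW hq) (leqW hp) _ _ hU.
  have [|g' [h' hgh']] := hE p q.+1 (leqW hq) hp (w - x *: g) (y + x *: h).
    by rewrite mulmxBr hz hgh -!scalemxAr mulmxDl -scalemxAl scalerDr addrA addrAC addrK.
  exists (map_mx sigma g'), (map_mx sigma h').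
  by rewrite -!map_mxM -map_mxD -hgh' -scaleN1r scalerA mulrC -scalerA map_mx_scale.
Qed.

End Transfer.

(** * Reduction modulo a regular sequence *)

Lemma factor_rmorphism (R A B : comNzRingType) (pA : {rmorphism R -> A})
    (pB : {rmorphism R -> B}) :
  Defs.surjective pA -> (forall r, pA r = 0 -> pB r = 0) ->
  exists sigma : {rmorphism A -> B}, forall r, sigma (pA r) = pB r.
Proof.
move=> /choice[s hs] hker.
have pBE r r' : pA r = pA r' -> pB r = pB r'.
  move=> h; apply/eqP; rewrite -subr_eq0 -rmorphB; apply/eqP/hker.
  by rewrite rmorphB h subrr.
pose f a := pB (s a).
have fB : zmod_morphism f.
  by move=> a b; rewrite /f -rmorphB; apply: pBE; rewrite rmorphB !hs.
have fM : monoid_morphism f.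
  split=> [|a b]; first by rewrite /f -(rmorph1 pB); apply: pBE; rewrite rmorph1 hs.
  by rewrite /f -rmorphM; apply: pBE; rewrite rmorphM !hs.
pose sigma : {rmorphism A -> B} := HB.pack f
  (GRing.isZmodMorphism.Build A B f fB) (GRing.isMonoidMorphism.Build A B f fM).
by exists sigma => r; apply: pBE; rewrite hs.
Qed.

Lemma quotient_proj (R : comNzRingType) (xs : seq R) (h : 1 \notin ideal_span xs) :
  exists p : {rmorphism R -> quotient_ring h},
    Defs.surjective p /\ forall a, p a = 0 <-> a \in ideal_span xs.
Proof.
exists (\pi_({ideal_quot (proper_span h)})%qT); split=> [y|a].
  by exists (repr y); exact: reprK.
have := Quotient.idealrBE (proper_span h) a 0; rewrite subr0 => E.
rewrite -(rmorph0 (\pi_({ideal_quot (proper_span h)})%qT)).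
by split=> [/eqP hp|ha]; [rewrite -E in hp | apply/eqP; rewrite -E].
Qed.

Lemma ideal_span_cat (R : comNzRingType) (xs ys : seq R) a :
  a \in ideal_span xs -> a \in ideal_span (xs ++ ys).
Proof.
elim/last_ind: ys => [|ys y IH] ha; first by rewrite cats0.
by rewrite -rcons_cat; apply/ideal_span_rcons; exists 0; rewrite mulr0 subr0 IH.
Qed.

Lemma self_orthogonal_regular (R : comNzRingType) (xs : seq R) b
    (D : forall i, 'M[R]_(b i.+1, b i)) n :
  regular_sequence xs -> self_orthogonal D 0 n ->
  forall j, (j <= size xs)%N -> forall (A : comNzRingType) (p : {rmorphism R -> A}),
  Defs.surjective p -> (forall a, p a = 0 <-> a \in ideal_span (take j xs)) ->
  self_orthogonal (fun i => map_mx p (D i)) j n.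
Proof.
move=> [xreg x1] hD; elim=> [|j IH] hj A p psurj pker.
  apply: self_orthogonal_bij => // a a' haa'; apply/eqP; rewrite -subr_eq0.
  apply/eqP/ideal_span_nil; rewrite -(take0 xs); apply/pker.
  by rewrite rmorphB haa' subrr.
have h1 : 1 \notin ideal_span (take j xs).
  by apply: contra x1 => /(ideal_span_cat (drop j xs)); rewrite cat_take_drop.
have [q [qsurj qker]] := quotient_proj h1.
have pker' a : p a = 0 <-> exists c, q a = q xs`_j * q c.
  rewrite pker (take_nth 0) // ideal_span_rcons.
  split=> -[c hc]; exists c; last first.
    by apply/qker; rewrite rmorphB rmorphM hc subrr.
  by apply/eqP; rewrite -rmorphM -subr_eq0 -rmorphB; apply/eqP/qker.
have [|sigma hsigma] := @factor_rmorphism _ _ _ q p qsurj.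
  by move=> r hr; apply/pker'; exists 0; rewrite hr rmorph0 mulr0.
have -> : (fun i => map_mx p (D i)) = (fun i => map_mx sigma (map_mx q (D i))).
  apply: functional_extensionality_dep => i.
  by apply/matrixP => k l; rewrite !mxE hsigma.
apply: (@self_orthogonal_quotient _ _ sigma _ (fun i => map_mx q (D i)) _ (q xs`_j)).
- by move=> a; have [r <-] := psurj a; exists (q r).
- move=> a; have [r <-] := qsurj a; rewrite hsigma pker'.
  split=> -[c hc]; first by exists (q c).
  by have [c' hc'] := qsurj c; exists c'; rewrite hc'.
- move=> a; have [r <-] := qsurj a; rewrite -rmorphM => /qker hr.
  exact/qker/(xreg (Ordinal hj)).
- by apply: IH => //; apply: ltnW.
Qed.

(** * Local rings with decomposable maximal ideal *)

(** A nonzero ideal [I] has an element outside [m * I]: the first member of a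
    minimal system of generators. *)
Lemma nakayama_generator (R : comNzRingType) (m I : {pred R}) x :
  noetherian R -> local_at m -> idealr_closed I -> x \in I -> x <> 0 ->
  exists2 a, a \in I & forall k (c d : 'I_k -> R),
    (forall i, c i \in m) -> (forall i, d i \in I) -> a <> \sum_i c i * d i.
Proof.
move=> hR hm hI xI x0; have [xs hxs] := hR I hI.
have [|r [g [hg gmin]]] := @minimal_generators _ _ hm R^o (fun v => v \in I).
  exists (size xs), (fun i => xs`_i) => v; rewrite hxs.
  split=> [/asboolP[c ->]|[c ->]]; last by apply/asboolP; exists (c 0).
  by exists (\row_i c i); apply: eq_bigr => i _; rewrite mxE.
case: r => [|r] in g hg gmin *.
  by have /hg[c] := xI; rewrite big_ord0 => /x0.
exists (g ord0).
  apply/hg; exists (delta_mx 0 ord0); rewrite (bigD1 ord0) //= mxE !eqxx scale1r.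
  by rewrite big1 ?addr0 // => i /negPf h; rewrite mxE h andbF scale0r.
move=> k c d cm dI hcd.
have /choice[e he] : forall j, exists e : 'rV[R]_r.+1, d j = \sum_i e 0 i *: g i.
  by move=> j; apply/hg.
pose u : 'rV[R]_r.+1 := \row_i (\sum_j c j * e j 0 i).
have um i : u 0 i \in m.
  by rewrite mxE; apply: (ideal_sum (proj1 hm)) => j; apply: (idealMr (proj1 hm)).
have /gmin/(_ 0 ord0) : \sum_i (delta_mx 0 ord0 - u) 0 i *: g i = 0.
  under eq_bigr do rewrite mxE scalerDl.
  rewrite big_split /= (bigD1 ord0) //= mxE !eqxx scale1r.
  rewrite [X in _ + X + _]big1 ?addr0 => [|i /negPf h]; last first.
    by rewrite mxE h andbF scale0r.
  rewrite hcd; under [X in X + _]eq_bigr do rewrite he mulr_sumr.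
  rewrite exchange_big -big_split /= big1 // => i _.
  rewrite !mxE scaleNr scaler_suml -sumrB big1 // => j _.
  by rewrite /GRing.scale /= mulrA subrr.
rewrite mxE mxE !eqxx /= [(- u) _ _]mxE => h.
by apply: (ideal1F (proj1 hm)); rewrite -(subrK (u 0 ord0) 1) (idealD (proj1 hm)).
Qed.

(** [m] is the internal direct sum of [I] and [J]; the last two fields hold
    because [I] and [J] are nonzero: [I] is not [m * I], and [J] is not
    [m * J]. *)
Record decomposable_max (R : comNzRingType) (m I J : {pred R}) : Prop :=
  DecomposableMax {
  dm_local : local_at m;
  dm_idealI : idealr_closed I;
  dm_idealJ : idealr_closed J;
  dm_disj : forall x, x \in I -> x \in J -> x = 0;
  dm_sum : forall x, x \in m -> exists a b, [/\ a \in I, b \in J & x = a + b];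
  dm_genI : exists2 a, a \in I & forall k (c d : 'I_k -> R),
    (forall i, c i \in m) -> (forall i, d i \in I) -> a <> \sum_i c i * d i;
  dm_genJ : exists2 a, a \in J & forall k (c d : 'I_k -> R),
    (forall i, c i \in m) -> (forall i, d i \in J) -> a <> \sum_i c i * d i
}.

Lemma decomposable_max_sym (R : comNzRingType) (m I J : {pred R}) :
  decomposable_max m I J -> decomposable_max m J I.
Proof.
case=> hm hI hJ d s gI gJ; split=> // [x xJ xI|x /s[a [b [aI bJ ->]]]].
  exact: d.
by exists b, a; rewrite addrC.
Qed.

Section Decomposable.
Variables (R : comNzRingType) (m : {pred R}).

Lemma decomp_mx (I J : {pred R}) p q (X : 'M[R]_(p, q)) :
  decomposable_max m I J -> mx_in m X ->
  exists Y Z, [/\ mx_in I Y, mx_in J Z & X = Y + Z].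
Proof.
move=> dm hX.
have /choice[f hf] : forall ij : 'I_p * 'I_q, exists ab : R * R,
    [/\ ab.1 \in I, ab.2 \in J & X ij.1 ij.2 = ab.1 + ab.2].
  move=> [i j]; have [a [c h]] := dm_sum dm (hX i j); by exists (a, c).
exists (\matrix_(i, j) (f (i, j)).1), (\matrix_(i, j) (f (i, j)).2).
split; first by move=> i j; rewrite mxE; have [] := hf (i, j).
  by move=> i j; rewrite mxE; have [] := hf (i, j).
by apply/matrixP => i j; rewrite !mxE; have [_ _ /= ->] := hf (i, j).
Qed.

Lemma decomp_mx0 (I J : {pred R}) p q (Y Z : 'M[R]_(p, q)) :
  decomposable_max m I J -> mx_in I Y -> mx_in J Z -> Y + Z = 0 -> Y = 0 /\ Z = 0.
Proof.
move=> dm hY hZ h.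
have hYZ : Y = - Z by apply/eqP; rewrite -addr_eq0 h.
have Y0 : Y = 0.
  apply/matrixP => i j; rewrite [RHS]mxE; apply: (dm_disj dm) => //.
  by rewrite hYZ mxE (idealN (dm_idealJ dm)).
by split=> //; rewrite Y0 add0r in h.
Qed.

Lemma decomp_mul0 (I J : {pred R}) x y :
  decomposable_max m I J -> x \in I -> y \in J -> x * y = 0.
Proof.
move=> dm xI yJ; apply: (dm_disj dm).
  exact: (idealMr (dm_idealI dm)).
exact: (idealMl (dm_idealJ dm)).
Qed.

Variables (b : nat -> nat) (D : forall i, 'M[R]_(b i.+1, b i)).
Variables (s n : nat).
Hypothesis hD : self_orthogonal D s n.
Hypothesis Dmin : forall i, mx_in m (D i).

(** A unimodular element of the free module of index [t.+1] that [D t] maps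
    into [I] times the next free module. Multiplication by [w] embeds the
    complementary ideal [J] into the kernel of [D t], and the [J]-component of
    the coordinate [l] is a retraction of this embedding when [s <= t]. *)
Definition retract_at (I : {pred R}) t :=
  exists (w : 'rV[R]_(b t.+1)) l, w 0 l = 1 /\ mx_in I (w *m D t).

Lemma retract_unit (I : {pred R}) t (w : 'rV[R]_(b t.+1)) l :
  local_at m -> idealr_closed I -> w 0 l \notin m -> mx_in I (w *m D t) ->
  retract_at I t.
Proof.
move=> hm hI /(proj2 hm)[y hy] hw; exists (y *: w), l; split.
  by rewrite mxE mulrC.
by move=> i j; rewrite -scalemxAl mxE (idealMl hI).
Qed.

Lemma retract_exists (I J : {pred R}) : decomposable_max m I J ->
  (0 < b s.+2)%N -> retract_at I s.+1 \/ retract_at J s.+1.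
Proof.
move=> dm b0; pose l := Ordinal b0.
have hm := dm_local dm; have mi := proj1 hm.
have [hI hJ] := (dm_idealI dm, dm_idealJ dm).
pose e : 'rV[R]_(b s.+2) := delta_mx 0 l.
have [Y [Z [hY hZ hYZ]]] := decomp_mx dm (mx_in_mulr mi e (@Dmin s.+1)).
have [|||Y0 Z0] := @decomp_mx0 I J _ _ (Y *m D s) (Z *m D s) dm.
- exact: mx_in_mull.
- exact: mx_in_mull.
- by rewrite -mulmxDl -hYZ -mulmxA (so_complex hD) mulmx0.
have [u hu] := so_exact hD (leqnn s) Y0.
have [w hw] := so_exact hD (leqnn s) Z0.
have [|z hz] := so_exact hD (leqnSn s) (v := e - (u + w)).
  by rewrite mulmxBl hYZ mulmxDl -hu -hw subrr.
(* [e - (u + w)] has its entries in [m], hence [u] or [w] has a unit entry *)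
have [ul|ul] := boolP (u 0 l \in m); last first.
  by left; apply: retract_unit ul _ => //; rewrite -hu.
have [wl|wl] := boolP (w 0 l \in m); last first.
  by right; apply: retract_unit wl _ => //; rewrite -hw.
have := mx_in_mulr mi z (@Dmin s.+2) 0 l; rewrite -hz !mxE !eqxx => h.
case: (ideal1F mi); rewrite -[1](subrK (u 0 l + w 0 l)).
by apply: idealD => //; apply: idealD.
Qed.

(** With [a] in [I] but not in [m * I], the element [a *: w] of the kernel of
    [D t] is the image of an element that has a unit coordinate. *)
Lemma retract_next (I J : {pred R}) t : decomposable_max m I J -> (s <= t)%N ->
  retract_at J t -> retract_at I t.+1.
Proof.
move=> dm st [w [l [wl hw]]]; have hm := dm_local dm.
have [hI hJ] := (dm_idealI dm, dm_idealJ dm).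
have [a aI agen] := dm_genI dm.
have aw0 : (a *: w) *m D t = 0.
  apply/matrixP => i j; rewrite -scalemxAl mxE [RHS]mxE.
  exact: (decomp_mul0 dm).
have [w' hw'] := so_exact hD st aw0.
have [/forallP h|] := boolP [forall k, w' 0 k \in m]; last first.
  rewrite negb_forall => /existsP[k hk]; apply: retract_unit hk _ => //.
  by rewrite -hw' => i j; rewrite mxE (idealMr hI).
(* the part of [w'] with entries in [I] would write [a] as an element of m I *)
have [|Y [Z [hY hZ hYZ]]] := @decomp_mx I J _ _ w' dm.
  by move=> i j; rewrite ord1.
have hal : a = (Y *m D t.+1) 0 l + (Z *m D t.+1) 0 l.
  transitivity ((a *: w) 0 l); first by rewrite mxE wl mulr1.
  by rewrite hw' hYZ mulmxDl [LHS]mxE.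
have /eqP : a - (Y *m D t.+1) 0 l = 0.
  apply: (dm_disj dm).
    by apply: idealB => //; apply: mx_in_mull.
  by rewrite {1}hal addrC addKr; apply: mx_in_mull.
rewrite subr_eq0 mxE => /eqP haY.
case: (agen _ (fun k => D t.+1 k l) (fun k => Y 0 k)) => [k|k|].
- exact: Dmin.
- exact: hY.
- by rewrite haY; apply: eq_bigr => k _; rewrite mulrC.
Qed.

(** The ideal [I] is a retract of ker (D t), which is coker (D t.+2), and so
    inherits the vanishing of Ext. The column [al] is a cocycle with values in
    [I]; it is enough that it bounds a column with entries in [m]. *)
Lemma retract_coboundary (I J : {pred R}) t p (al : 'cV[R]_(b p.+2)) :
  decomposable_max m I J -> (s <= t)%N -> (n + t <= p)%N -> retract_at J t ->
  mx_in I al -> D p.+2 *m al = 0 ->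
  exists2 ga : 'cV[R]_(b p.+1), mx_in m ga & al = D p.+1 *m ga.
Proof.
move=> dm st hp [w [l [wl hw]]] hal al0; have mi := proj1 (dm_local dm).
have [|F hF] := exact_from_mx (A := al *m w) (so_exact hD) st.
  apply/matrixP => i j; rewrite -mulmxA mxE big_ord1 [RHS]mxE.
  by apply: (decomp_mul0 dm).
have [|G hG] := exact_from_mx (A := D p.+2 *m F) (so_exact hD) (leqW st).
  by rewrite -mulmxA -hF mulmxA al0 mul0mx.
have [||g [h hgh]] := so_syz hD (p := p.+1) (q := t.+2) _ _ hG.
- exact: leqW (leqW st).
- by rewrite !addnS.
exists (col l (g *m D t.+1)).
  by move=> i j; rewrite mxE; apply: mx_in_mulr.
have -> : al = col l (al *m w).
  by apply/matrixP => i j; rewrite mxE mxE big_ord1 wl mulr1 !ord1.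
rewrite hF hgh mulmxDl -!mulmxA (so_complex hD) mulmx0 addr0.
by rewrite !colE !mulmxA.
Qed.

(** A basis vector [e], read as a map to the residue field, is a cocycle. The two
    components of its coboundary in [I] and [J] bound columns in [m]; correcting
    [e] by them gives a cocycle with values in [R], hence a coboundary, whose
    entries lie in [m] by minimality. *)
Lemma rank_zero_of_retracts (I J : {pred R}) t1 t2 p : decomposable_max m I J ->
  (s <= t1)%N -> (s <= t2)%N -> (n + t1 <= p)%N -> (n + t2 <= p)%N ->
  retract_at I t1 -> retract_at J t2 -> b p.+1 = 0%N.
Proof.
move=> dm s1 s2 h1 h2 r1 r2; have mi := proj1 (dm_local dm).
case E: (b p.+1) => [//|r]; have b0 : (0 < b p.+1)%N by rewrite E.
pose l := Ordinal b0.
pose e : 'cV[R]_(b p.+1) := delta_mx l 0.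
have [Y [Z [hY hZ hYZ]]] := decomp_mx dm (mx_in_mull mi e (@Dmin p.+1)).
have [|||Y0 Z0] := @decomp_mx0 I J _ _ (D p.+2 *m Y) (D p.+2 *m Z) dm.
- by apply: mx_in_mulr => //; apply: dm_idealI dm.
- by apply: mx_in_mulr => //; apply: dm_idealJ dm.
- by rewrite -mulmxDr -hYZ mulmxA (so_complex hD) mul0mx.
have [ga gam hga] := retract_coboundary dm s2 h2 r2 hY Y0.
have [de dem hde] := retract_coboundary (decomposable_max_sym dm) s1 h1 r1 hZ Z0.
have hp : (n <= p.+1)%N by apply: leqW; apply: leq_trans h1; apply: leq_addr.
have [|g hg] := so_ring hD hp (f := e - (ga + de)).
  by rewrite mulmxBr hYZ mulmxDr -hga -hde subrr.
have := mx_in_mull mi g (@Dmin p) l 0; rewrite -hg !mxE !eqxx => h.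
case: (ideal1F mi); rewrite -[1](subrK (ga l 0 + de l 0)).
by apply: idealD => //; apply: idealD.
Qed.

Lemma rank_zero_next p : local_at m -> (s <= p)%N -> b p = 0%N -> b p.+1 = 0%N.
Proof.
move=> hm sp bp; case E: (b p.+1) => [//|r].
have b0 : (0 < b p.+1)%N by rewrite E.
have [|u hu] := so_exact hD sp (v := delta_mx 0 (Ordinal b0)).
  by apply/matrixP => i j; exfalso; move: j; rewrite bp => -[].
have := mx_in_mulr (proj1 hm) u (@Dmin p.+1) 0 (Ordinal b0).
by rewrite -hu mxE !eqxx => /(ideal1F (proj1 hm)).
Qed.

(** Either a rank in the exact range is zero, and so are the following ones, or
    [I] and [J] are both retracts of syzygies. *)
Lemma rank_zero_eventually (I J : {pred R}) : decomposable_max m I J ->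
  exists P, forall p, (P <= p)%N -> b p = 0%N.
Proof.
move=> dm; have dm' := decomposable_max_sym dm.
have [b0|b0] := posnP (b s.+2).
  exists s.+2; elim=> [|p IH] // hp.
  move: hp; rewrite leq_eqVlt => /orP[/eqP <- //|hp].
  by apply: rank_zero_next (IH hp) => //; [exact: dm_local dm | rewrite ltnW // ltnW].
exists (n + s.+2).+1 => -[//|p] hp.
have h2 : (n + s.+2 <= p)%N by [].
have h1 : (n + s.+1 <= p)%N by apply: leq_trans h2; rewrite leq_add2l.
have [r|r] := retract_exists dm b0.
  have r' := retract_next dm' (leqnSn s) r.
  by apply: (rank_zero_of_retracts dm _ _ h1 h2 r r'); rewrite ltnW // ltnW.
have r' := retract_next dm (leqnSn s) r.
by apply: (rank_zero_of_retracts dm _ _ h2 h1 r' r); rewrite ltnW // ltnW.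
Qed.

End Decomposable.

(** * Fiber products *)

(** In S x_k T, the ideal [I] consists of the pairs (s, 0) and [J] of the pairs
    (0, t); they are nonzero because neither projection to k is injective. *)
Lemma fiber_product_decomposable (Q : comNzRingType) :
  fiber_product_ring Q -> exists m I J : {pred Q}, decomposable_max m I J.
Proof.
move=> [hQ [S [T [k [pS [pT [_ [surjS surjT] [nbS nbT] [phi phibij]]]]]]]].
have phi_inj := bij_inj phibij.
have phi_surj s t : pS s = pT t -> exists x, fiber_val (phi x) = (s, t).
  move=> h; have hst : (s, t) \in fiber_pred pS pT by rewrite inE /= h.
  have [psi _ psiK] := phibij.
  by exists (psi (FiberProduct hst)); rewrite psiK.
pose fs x := (fiber_val (phi x)).1; pose ft x := (fiber_val (phi x)).2.
have fsE x : pS (fs x) = pT (ft x) by have := fiberP (phi x); rewrite inE => /eqP.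
have fext x y : fs x = fs y -> ft x = ft y -> x = y.
  move=> h1 h2; apply: phi_inj; apply: val_inj => /=.
  by rewrite [LHS]surjective_pairing [RHS]surjective_pairing; congr pair.
have fs0 : fs 0 = 0 by rewrite /fs rmorph0.
have ft0 : ft 0 = 0 by rewrite /ft rmorph0.
have fs1 : fs 1 = 1 by rewrite /fs rmorph1.
have ft1 : ft 1 = 1 by rewrite /ft rmorph1.
have fsl a u v : fs (a * u + v) = fs a * fs u + fs v by rewrite /fs rmorphD rmorphM.
have ftl a u v : ft (a * u + v) = ft a * ft u + ft v by rewrite /ft rmorphD rmorphM.
pose m : {pred Q} := fun x => pS (fs x) == 0.
pose I : {pred Q} := fun x => ft x == 0.
pose J : {pred Q} := fun x => fs x == 0.
have hmi : idealr_closed m.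
  split; rewrite /m ?unfold_in ?fs0 ?fs1 ?rmorph0 ?rmorph1 ?oner_eq0 //.
  move=> a u v; rewrite !unfold_in => /eqP hu /eqP hv.
  by rewrite fsl rmorphD rmorphM hu hv mulr0 addr0.
have hI : idealr_closed I.
  split; rewrite /I ?unfold_in ?ft0 ?ft1 ?oner_eq0 //.
  by move=> a u v; rewrite !unfold_in ftl => /eqP-> /eqP->; rewrite mulr0 addr0.
have hJ : idealr_closed J.
  split; rewrite /J ?unfold_in ?fs0 ?fs1 ?oner_eq0 //.
  by move=> a u v; rewrite !unfold_in fsl => /eqP-> /eqP->; rewrite mulr0 addr0.
have hmax : maximal_ideal m.
  split=> // I' hI' mI' x; apply/idP/idP; last exact: mI'.
  move=> xI'; apply/negPn/negP => hx; apply: (ideal1F hI').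
  have [s hs] := surjS (pS (fs x))^-1; have [t ht] := surjT (pS (fs x))^-1.
  have [|y hy] := phi_surj s t; first by rewrite hs ht.
  rewrite -(subrK (x * y) 1); apply: idealD => //; last exact: idealMr.
  apply: mI'; rewrite /m unfold_in.
  have -> : 1 - x * y = - x * y + 1 by rewrite addrC mulNr.
  have fsN : fs (- x) = - fs x by rewrite /fs rmorphN.
  rewrite fsl fsN fs1 rmorphD rmorphM rmorphN rmorph1 [fs y](congr1 fst hy) hs.
  by rewrite mulNr mulfV // addNr.
have hm := local_ring_at hQ hmax.
have [hN _] := hQ.
have nzker (U : comNzRingType) (pU : {rmorphism U -> k}) :
    Defs.surjective pU -> ~ bijective pU -> exists2 u, pU u = 0 & u <> 0.
  move=> sU nU; apply: contrapT => hu; apply: nU.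
  have /choice[r hr] := sU; exists r => // u; apply/eqP; rewrite -subr_eq0.
  apply/eqP; apply: contrapT => h; apply: hu; exists (r (pU u) - u) => //.
  by rewrite rmorphB hr subrr.
exists m, I, J; split=> //.
- move=> x; rewrite !unfold_in => /eqP xI /eqP xJ.
  by apply: fext; rewrite ?fs0 ?ft0.
- move=> x; rewrite unfold_in => /eqP xm.
  have [|a ha] := phi_surj (fs x) 0; first by rewrite xm rmorph0.
  have [|c hc] := phi_surj 0 (ft x); first by rewrite -fsE xm rmorph0.
  have [as_ at_] : fs a = fs x /\ ft a = 0 by rewrite /fs /ft ha.
  have [cs ct] : fs c = 0 /\ ft c = ft x by rewrite {1}/fs {1}/ft hc.
  exists a, c; split; rewrite ?unfold_in ?at_ ?cs //.
  apply: fext; rewrite -[a]mul1r ?fsl ?ftl ?fs1 ?ft1 mul1r.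
    by rewrite as_ cs addr0.
  by rewrite at_ ct add0r.
- have [s s0 sn0] := nzker _ _ surjS nbS.
  have [|x hx] := phi_surj s 0; first by rewrite s0 rmorph0.
  apply: (nakayama_generator (x := x)) => //; first by rewrite unfold_in /I /ft hx.
  by move=> x0; apply: sn0; rewrite -fs0 -x0 /fs hx.
- have [t t0 tn0] := nzker _ _ surjT nbT.
  have [|x hx] := phi_surj 0 t; first by rewrite t0 rmorph0.
  apply: (nakayama_generator (x := x)) => //; first by rewrite unfold_in /J /fs hx.
  by move=> x0; apply: tn0; rewrite -ft0 -x0 /ft hx.
Qed.

(** * Ext and the choice of the projective resolution *)

Section Linear.
Variable R : comNzRingType.

Lemma linear_ex (U V : lmodType R) (f : U -> V) :
  linear f -> exists g : {linear U -> V}, forall x, g x = f x.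
Proof.
move=> hf; pose g : {linear U -> V} := HB.pack f (GRing.isLinear.Build R U V _ f hf).
by exists g.
Qed.

(** The image of a linear map, as a module of its own. *)
Section Image.
Variables (A B : lmodType R) (g : {linear A -> B}).

Definition image_pred : {pred B} := fun y => `[< exists x, g x = y >].

Fact image_pred_closed : GRing.submod_closed image_pred.
Proof.
split=> [|a u v /asboolP[x <-] /asboolP[y <-]]; apply/asboolP.
  by exists 0; rewrite raddf0.
by exists (a *: x + y); rewrite linearP.
Qed.

HB.instance Definition _ :=
  GRing.isSubmodClosed.Build R B image_pred image_pred_closed.

Record image := Image { image_val : B; imageP : image_val \in image_pred }.

HB.instance Definition _ := [isSub for image_val].
HB.instance Definition _ := [Choice of image by <:].
HB.instance Definition _ := [SubChoice_isSubLmodule of image by <:].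

End Image.

(** The lifting property against a map [g] that need not be surjective. *)
Lemma projective_lift (P A B : lmodType R) (g : {linear A -> B})
    (f : {linear P -> B}) :
  projective P -> (forall x, exists a, g a = f x) ->
  exists h : {linear P -> A}, forall x, g (h x) = f x.
Proof.
move=> hP hf.
have hg' a : g a \in image_pred g by apply/asboolP; exists a.
have hf' x : f x \in image_pred g by apply/asboolP; apply: hf.
have [g' g'E] : exists g' : {linear A -> image g}, forall a, g' a = Image (hg' a).
  by apply: linear_ex => a u v; apply: val_inj; rewrite /= linearP.
have [f' f'E] : exists f' : {linear P -> image g}, forall x, f' x = Image (hf' x).
  by apply: linear_ex => a u v; apply: val_inj; rewrite /= linearP.
have [|h hh] := hP _ _ g' f'.
  move=> [y hy]; have /asboolP[a ha] := hy; exists a.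
  by rewrite g'E; apply: val_inj.
by exists h => x; have := congr1 val (hh x); rewrite g'E f'E.
Qed.

End Linear.

(** Dependent choice along [nat] for a family of types, under an invariant. *)
Lemma dependent_recursion (T : nat -> Type) (Inv : forall i, T i -> Prop)
    (Rel : forall i, T i -> T i.+1 -> Prop) (x0 : T 0%N) :
  Inv 0%N x0 -> (forall i x, Inv i x -> exists y, Inv i.+1 y /\ Rel i x y) ->
  exists f : forall i, T i, f 0%N = x0 /\ forall i, Rel i (f i) (f i.+1).
Proof.
move=> h0 hS.
pose next i (x : {x | Inv i x}) : {y | Inv i.+1 y /\ Rel i (sval x) y} :=
  cid (hS i (sval x) (svalP x)).
pose fix F i : {x | Inv i x} := match i with
  | 0 => exist _ x0 h0
  | j.+1 => exist _ (sval (next j (F j))) (proj1 (svalP (next j (F j))))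
  end.
by exists (fun i => sval (F i)); split=> // i; exact: (proj2 (svalP (next i (F i)))).
Qed.

Section Comparison.
Variables (R : comNzRingType) (M : lmodType R).

Lemma res_diff2 (P : proj_resolution M) i x : res_diff P i (res_diff P i.+1 x) = 0.
Proof. by apply/res_exact; exists x. Qed.

Lemma res_aug_diff (P : proj_resolution M) x : res_aug P (res_diff P 0%N x) = 0.
Proof. by apply/res_exact0; exists x. Qed.

(** A lift of the identity of [M]. The invariant of the recursion says that the
    part built so far maps boundaries to boundaries. *)
Lemma chain_map_ex (P Q : proj_resolution M) :
  exists al : forall i, {linear P i -> Q i},
    (forall x, res_aug Q (al 0%N x) = res_aug P x) /\
    forall i x, res_diff Q i (al i.+1 x) = al i (res_diff P i x).
Proof.
have [x|al0 hal0] := @projective_lift _ _ _ _ (res_aug Q) (res_aug P)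
  (@res_projective _ _ P 0%N).
  exact: res_aug_surj.
pose Inv i (al : {linear P i -> Q i}) :=
  forall x, exists y, res_diff Q i y = al (res_diff P i x).
pose Rel i (al : {linear P i -> Q i}) (al' : {linear P i.+1 -> Q i.+1}) :=
  forall x, res_diff Q i (al' x) = al (res_diff P i x).
have [||al [e0 hal]] := @dependent_recursion (fun i => {linear P i -> Q i}) Inv Rel al0.
- by move=> x; apply/res_exact0; rewrite hal0 res_aug_diff.
- move=> i al hal.
  have [x|al' hal'] := @projective_lift _ _ _ _ (res_diff Q i) (al \o res_diff P i)
    (@res_projective _ _ P i.+1); first exact: hal.
  exists al'; split=> // x; apply/res_exact.
  by rewrite hal' /= res_diff2 raddf0.
by exists al; split=> // x; rewrite e0.
Qed.

(** A chain endomorphism over the identity of [M] is homotopic to the identity. *)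
Lemma homotopy_ex (F : proj_resolution M) (ga : forall i, {linear F i -> F i}) :
  (forall x, res_aug F (ga 0%N x) = res_aug F x) ->
  (forall i x, res_diff F i (ga i.+1 x) = ga i (res_diff F i x)) ->
  exists s : forall i, {linear F i -> F i.+1}, forall i x,
    res_diff F i.+1 (s i.+1 x) = ga i.+1 x - x - s i (res_diff F i x).
Proof.
move=> ga0 gaS.
pose d0 : {linear F 0%N -> F 0%N} := ga 0%N \- idfun.
have [x|s0 hs0] := @projective_lift _ _ _ _ (res_diff F 0%N) d0
  (@res_projective _ _ F 0%N).
  by apply/res_exact0; rewrite /d0 /= raddfB /= ga0 subrr.
pose Inv i (s : {linear F i -> F i.+1}) := forall x,
  res_diff F i (s (res_diff F i x)) = ga i (res_diff F i x) - res_diff F i x.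
pose Rel i (s : {linear F i -> F i.+1}) (s' : {linear F i.+1 -> F i.+2}) :=
  forall x, res_diff F i.+1 (s' x) = ga i.+1 x - x - s (res_diff F i x).
have [||s [_ hs]] := @dependent_recursion (fun i => {linear F i -> F i.+1}) Inv Rel s0.
- by move=> x; rewrite hs0.
- move=> i s hs.
  pose d : {linear F i.+1 -> F i.+1} := ga i.+1 \- idfun \- (s \o res_diff F i).
  have [x|s' hs'] := @projective_lift _ _ _ _ (res_diff F i.+1) d
    (@res_projective _ _ F i.+1).
    by apply/res_exact; rewrite /d /= !raddfB /= gaS hs subrr.
  exists s'; split=> x; rewrite hs' //=.
  by rewrite res_diff2 raddf0 subr0.
by exists s.
Qed.

(** Vanishing of the cohomology of Hom(P, N) in degree [i.+1] does not depend
    on [P]. *)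
Lemma cocycle_coboundary_indep (P F : proj_resolution M) (N : lmodType R) i :
  (forall f : {linear P i.+1 -> N}, cocycle f -> coboundary f) ->
  forall f : {linear F i.+1 -> N}, cocycle f -> coboundary f.
Proof.
move=> hP f hf; have [al [al0 alS]] := chain_map_ex P F.
have [be [be0 beS]] := chain_map_ex F P.
have [||s hs] := @homotopy_ex F (fun i => al i \o be i : {linear F i -> F i}).
- by move=> x /=; rewrite al0 be0.
- by move=> j x /=; rewrite alS beS.
have [|g hg] := hP (f \o al i.+1 : {linear P i.+1 -> N}).
  by move=> y /=; rewrite -alS hf.
pose h : {linear F i -> N} := (g \o be i) \- (f \o s i).
exists h => x; rewrite /h /= -beS -hg /=.
have := congr1 f (hs i x); rewrite hf !raddfB /= => /esym/eqP.
rewrite subr_eq0 => /eqP <-.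
by rewrite opprB addrC subrK.
Qed.

Lemma Ext_zero_cocycle (F : proj_resolution M) (N : lmodType R) i :
  Ext_zero i.+1 M N -> forall f : {linear F i.+1 -> N}, cocycle f -> coboundary f.
Proof. by move=> [P hP]; apply: cocycle_coboundary_indep hP. Qed.

End Comparison.

Section FreeResolution.
Variables (R : comNzRingType) (m : {pred R}) (M : lmodType R).
Variables (b : nat -> nat) (D : forall i, 'M[R]_(b i.+1, b i)) (g : 'I_(b 0%N) -> M).
Hypothesis hmr : minimal_resolution m D g.

Lemma rV_basis (k : nat) (V : lmodType R) (h : 'I_k -> V) :
  exists f : {linear 'rV[R]_k -> V}, forall c, f c = \sum_i c 0 i *: h i.
Proof.
apply: linear_ex => a u v; rewrite scaler_sumr -big_split /=.
by apply: eq_bigr => i _; rewrite !mxE scalerDl scalerA.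
Qed.

Lemma linear_rV (k : nat) (V : lmodType R) (f : {linear 'rV[R]_k -> V}) c :
  f c = \sum_i c 0 i *: f (delta_mx 0 i).
Proof.
by rewrite {1}[c]row_sum_delta raddf_sum /=; apply: eq_bigr => i _; rewrite linearZ.
Qed.

Lemma projective_rV k : projective 'rV[R]_k.
Proof.
move=> A B p f hp.
have /choice[h hh] : forall i : 'I_k, exists a, p a = f (delta_mx 0 i).
  by move=> i; apply: hp.
have [q hq] := rV_basis h; exists q => x.
rewrite hq raddf_sum linear_rV /=; apply: eq_bigr => i _.
by rewrite linearZ /= hh.
Qed.

(** The map from the first free module onto [M] given by the generators [g]. *)
Definition free_aug := sval (cid (rV_basis g)).

Lemma free_augE c : free_aug c = \sum_i c 0 i *: g i.
Proof. exact: svalP (cid (rV_basis g)) c. Qed.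

Lemma free_aug_surj : Defs.surjective free_aug.
Proof. by move=> x; have [c ->] := mr_gen hmr x; exists c; rewrite free_augE. Qed.

Lemma free_exact0 (x : 'rV[R]_(b 0%N)) :
  free_aug x = 0 <-> exists y, mulmxr (D 0%N) y = x.
Proof.
rewrite free_augE (mr_exact0 hmr).
by split=> -[u hu]; exists u.
Qed.

Lemma free_exact i (x : 'rV[R]_(b i.+1)) :
  mulmxr (D i) x = 0 <-> exists y, mulmxr (D i.+1) y = x.
Proof. by rewrite /= (mr_exact hmr); split=> -[u hu]; exists u. Qed.

Definition free_resolution : proj_resolution M :=
  @ProjResolution R M (fun i => 'rV[R]_(b i)) (fun i => mulmxr (D i)) free_aug
    (fun i => @projective_rV (b i)) free_aug_surj free_exact0 free_exact.

Lemma mr_complex : is_complex D.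
Proof.
move=> i; apply/row_matrixP => j; rewrite row_mul row0.
by apply/(mr_exact hmr); exists (delta_mx 0 j); rewrite rowE.
Qed.

(** A cocycle modulo the image of [D 0] is a cocycle with values in [M] through
    the augmentation; a map to [M] that bounds it lifts to a matrix. *)
Lemma Ext_zero_syz p : Ext_zero p.+1 M (M * R^o)%type -> ext_syz_zero D p 0.
Proof.
move=> hE f e hfe.
have [F hF] : exists F : {linear 'rV[R]_(b p.+1) -> (M * R^o)%type},
    forall x, F x = (free_aug (x *m f), 0).
  apply: linear_ex => a u v; rewrite mulmxDl -scalemxAl linearP.
  by rewrite -[RHS]/(_, a *: (0 : R^o) + 0) scaler0 addr0.
have [|G hG] := @Ext_zero_cocycle _ _ free_resolution _ p hE F.
  move=> y; rewrite hF /= -mulmxA hfe mulmxA; congr pair.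
  by apply/free_exact0; exists (y *m e).
have /choice[h hh] : forall i, exists u, free_aug u = (G (delta_mx 0 i)).1.
  by move=> i; apply: free_aug_surj.
pose H : 'M[R]_(b p, b 0%N) := \matrix_i h i.
have HE u : free_aug (u *m H) = (G u).1.
  rewrite mulmx_sum_row raddf_sum /= linear_rV.
  have fst_sum (I : Type) (r : seq I) (X : I -> (M * R^o)%type) :
    (\sum_(i <- r) X i).1 = \sum_(i <- r) (X i).1 by exact: (big_morph fst).
  by rewrite fst_sum; apply: eq_bigr => i _; rewrite linearZ /= rowK hh.
have [|k hk] := @exact_rows _ _ _ _ (f - D p *m H) (D 0%N).
  move=> i; rewrite rowE; apply/(mr_exact0 hmr); rewrite -free_augE.
  rewrite mulmxBr raddfB /= mulmxA HE.
  by have := congr1 fst (hG (delta_mx 0 i)); rewrite hF /= => ->; rewrite subrr.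
by exists H, k; rewrite -hk addrC subrK.
Qed.

Lemma Ext_zero_ring p : Ext_zero p.+1 M (M * R^o)%type -> ext_ring_zero D p.
Proof.
move=> hE c f hf.
have /choice[h hh] : forall j : 'I_c, exists h : 'cV[R]_(b p), col j f = D p *m h.
  move=> j.
  have [F hF] : exists F : {linear 'rV[R]_(b p.+1) -> (M * R^o)%type},
      forall x, F x = (0, (x *m f) 0 j).
    apply: linear_ex => a u v; rewrite mulmxDl -scalemxAl 2!mxE.
    by rewrite -[RHS]/(a *: (0 : M) + 0, _) scaler0 addr0.
  have [|G hG] := @Ext_zero_cocycle _ _ free_resolution _ p hE F.
    by move=> y; rewrite hF /= -mulmxA hf mulmx0 mxE.
  exists (\col_i (G (delta_mx 0 i)).2); apply/colP => i.
  pose e : 'rV[R]_(b p.+1) := delta_mx 0 i.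
  have eE : (e *m f) 0 j = (G (e *m D p)).2.
    by have := congr1 snd (hG e); rewrite hF.
  have -> : col j f i 0 = (e *m f) 0 j by rewrite -rowE !mxE.
  have snd_sum (I : Type) (r : seq I) (X : I -> (M * R^o)%type) :
    (\sum_(i <- r) X i).2 = \sum_(i <- r) (X i).2 by exact: (big_morph snd).
  rewrite eE -rowE linear_rV snd_sum mxE; apply: eq_bigr => k _.
  by rewrite /= !mxE.
exists (\matrix_(i, j) h j i 0); apply/matrixP => i j.
have /colP/(_ i) := hh j; rewrite mxE => ->; rewrite !mxE.
by apply: eq_bigr => k _; rewrite mxE.
Qed.

End FreeResolution.

(** * The Auslander-Reiten conditions *)

(** A surjection with proper kernel (xs) maps the nonunits of [R] to nonunits,
    since the kernel lies in [m]. *)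
Lemma map_local (R Q : comNzRingType) (p : {rmorphism R -> Q}) (m : {pred R})
    (mQ : {pred Q}) xs :
  local_at m -> local_at mQ -> Defs.surjective p -> 1 \notin ideal_span xs ->
  (forall a, p a = 0 <-> a \in ideal_span xs) ->
  forall x, x \in m -> p x \in mQ.
Proof.
move=> hm hmQ psurj x1 pker x xm; apply/negPn/negP => /(proj2 hmQ)[y'].
have [y <-] := psurj y'; rewrite -rmorphM -(rmorph1 p) => h.
have /pker hxy : p (x * y - 1) = 0 by rewrite rmorphB h subrr.
have := local_at_ideal hm (ideal_span_closed x1) hxy.
move=> hxym; apply: (ideal1F (proj1 hm)).
have -> : 1 = x * y - (x * y - 1) by rewrite opprB addrC subrK.
by apply: (idealB (proj1 hm)) => //; apply: (idealMr (proj1 hm)).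
Qed.

(** If [b p.+2 = 0], then the identity matrix of size [b p.+1] is a cocycle, hence
    a multiple of [D p], whose entries lie in [m]. *)
Lemma rank_zero_descent (R : comNzRingType) (m : {pred R}) b
    (D : forall i, 'M[R]_(b i.+1, b i)) s n p :
  local_at m -> self_orthogonal D s n -> (forall i, mx_in m (D i)) ->
  (n <= p.+1)%N -> b p.+2 = 0%N -> b p.+1 = 0%N.
Proof.
move=> hm hD Dmin hp b0; case E: (b p.+1) => [//|r].
have b1 : (0 < b p.+1)%N by rewrite E.
have [|h hh] := so_ring hD hp (f := 1%:M).
  by apply/matrixP => i; exfalso; move: i; rewrite b0 => -[].
have := mx_in_mull (proj1 hm) h (@Dmin p) (Ordinal b1) (Ordinal b1).
by rewrite -hh mxE eqxx => /(ideal1F (proj1 hm)).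
Qed.

Lemma quasi_fiber_finite_resolution (R : comNzRingType) (M : lmodType R) n :
  quasi_fiber_product_ring R -> fin_gen M -> (0 < n)%N ->
  (forall i, (n <= i)%N -> Ext_zero i M (M * R^o)%type) ->
  exists m b D g, @minimal_resolution R m M b D g /\
    forall i, (n <= i)%N -> b i = 0%N.
Proof.
move=> [hR [xs [hxs hQ]]] hM n0 hE.
have [hN [m [hmax _]]] := hR; have hm := local_ring_at hR hmax.
have [b [D [g hmr]]] := minimal_resolution_exists hN hm hM.
exists m, b, D, g; split=> //.
have hD : self_orthogonal D 0 n.
  apply: self_orthogonal0 => //.
  - exact: mr_complex hmr.
  - by move=> i _ v /(mr_exact hmr).
  - by move=> p hp; apply: (Ext_zero_ring hmr); apply: hE.
  - by move=> p hp; apply: (Ext_zero_syz hmr); apply: hE.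
have [p [psurj pker]] := quotient_proj (proj2 hxs).
have hDQ : self_orthogonal (fun i => map_mx p (D i)) (size xs) n.
  by apply: (self_orthogonal_regular hxs hD (leqnn _)) => //; rewrite take_size.
have [mQ [I [J dm]]] := fiber_product_decomposable hQ.
have DQmin i : mx_in mQ (map_mx p (D i)).
  move=> k l; rewrite mxE.
  apply: (map_local hm (dm_local dm) psurj (proj2 hxs) pker).
  exact: (mr_min hmr).
have [P hP] := rank_zero_eventually hDQ DQmin dm.
suff down d i : (n <= i)%N -> (P <= i + d)%N -> b i = 0%N.
  by move=> i hi; apply: (down P) => //; apply: leq_addl.
elim: d i => [|d IH] i hi hPi; first by apply: hP; rewrite addn0 in hPi.
have bi1 : b i.+1 = 0%N by apply: IH; [exact: leqW | rewrite addSnnS].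
case: i hi bi1 {hPi} => [|i] hi bi1; first by move: n0; rewrite lt0n -leqn0 hi.
exact: (rank_zero_descent hm hD (mr_min hmr) hi bi1).
Qed.

Theorem corollary3p8 (R : comNzRingType) (hR : quasi_fiber_product_ring R) :
  generalized_auslander_reiten R /\ auslander_reiten R.
Proof.
split=> [M n|M] hM => [n0|] hE.
  have [m [b [D [g [hmr b0]]]]] := quasi_fiber_finite_resolution hR hM n0 hE.
  exists (free_resolution hmr) => i /b0 bi; change (forall x : 'rV[R]_(b i), x = 0).
  by rewrite bi => x; apply/rowP => -[].
have [m [b [D [g [hmr b0]]]]] := quasi_fiber_finite_resolution hR hM (ltn0Sn 0) hE.
exists (b 0%N), g => x; have [c hc] := mr_gen hmr x.
exists c; split=> // c' hc'; apply/eqP; rewrite -subr_eq0; apply/eqP.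
have /(mr_exact0 hmr)[u ->] : \sum_i (c - c') 0 i *: g i = 0.
  under eq_bigr do rewrite !mxE scalerDl scaleNr.
  by rewrite sumrB -hc -hc' subrr.
apply/rowP => j; rewrite !mxE big1 // => k _; exfalso.
by move: k; rewrite (b0 1%N) // => -[].
Qed.
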